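(* Let $\mathcal{T}_r$ be the set of (isomorphism classes of) rooted trees. The function $P:\mathcal{T}_r\to\mathbb{Z}[x,y]$ is injective; that is, non-isomorphic rooted trees have different polynomials.
   Context: All trees are finite and unlabeled. A rooted tree is a tree with one distinguished vertex (the root); isomorphisms of rooted trees preserve the root, and rooted trees are considered up to isomorphism. $\bullet$ denotes the one-vertex rooted tree. For $k\ge 1$ and rooted trees $T_1,\dots,T_k$, $\wedge_k(T_1,\dots,T_k)$ denotes the rooted tree obtained by pasting the roots of $T_1,\dots,T_k$ to the $k$ leaf vertices of the rooted $k$-star (root with $k$ children), i.e. a new root whose $k$ children are the roots of $T_1,\dots,T_k$. Every rooted tree other than $\bullet$ is of this form, uniquely up to reordering and isomorphism of the $T_i$. The polynomial $P(T)\in\mathbb{Z}[x,y]$ of a rooted tree $T$ is defined recursively by $P(\bullet)=x$ and $P(\wedge_k(T_1,\dots,T_k))=y+\prod_{i=1}^k P(T_i)$ for $k\ge 1$. *)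

(* Defs.v *)
From mathcomp Require Import all_boot all_order all_algebra.
From mathcomp.multinomials Require Import mpoly.

Set Implicit Arguments.
Unset Strict Implicit.
Unset Printing Implicit Defensive.

Import GRing.Theory.

Local Open Scope ring_scope.

(* A finite rooted tree: a nonempty finite connected simple graph without
   cycles, with a distinguished vertex.  [ucycle adj c] also holds of the
   degenerate closed walks of length at most 2 (a vertex, an edge traversed
   back and forth), hence the bound on [size c]. *)
Record rooted_tree : Type := RootedTree {
  vertex : finType;
  adj : rel vertex;
  root : vertex;
  adj_sym : ssrbool.symmetric adj;
  adj_irr : irreflexive adj;
  adj_connected : forall u v : vertex, connect adj u v;
  adj_acyclic : forall c : seq vertex, ucycle adj c -> (size c < 3)%N
}.

Definition rooted_iso (T1 T2 : rooted_tree) : Prop :=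
  exists f : vertex T1 -> vertex T2,
    [/\ bijective f, {mono f : u v / adj u v} & f (root T1) = root T2].

Definition px : {mpoly int[2]} := 'X_ord0.
Definition py : {mpoly int[2]} := 'X_ord_max.

Section BranchPoly.
Variables (V : finType) (e : rel V).

(* The neighbours of v on the side away from p.  When v is the root we take
   p = v, which excludes nothing since e is irreflexive. *)
Definition children (p v : V) : {set V} := [set w | e v w & w != p].

(* The polynomial of the branch at v, where p is the parent of v; n bounds the
   depth of the recursion. *)
Fixpoint branch_poly (n : nat) (p v : V) : {mpoly int[2]} :=
  if n is m.+1 then
    if children p v == set0 then px
    else py + \prod_(w in children p v) branch_poly m v w
  else 0.

End BranchPoly.

(* A branch has at most #|vertex T| levels, so the recursion bound is never
   reached: see tree_poly_bullet and tree_poly_wedge below for the defining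
   recursion. *)
Definition tree_poly (T : rooted_tree) : {mpoly int[2]} :=
  branch_poly (@adj T) #|vertex T| (root T) (root T).

Section Bullet.
Let e : rel unit := fun _ _ => false.

Fact bullet_sym : ssrbool.symmetric e. Proof. by []. Qed.
Fact bullet_irr : irreflexive e. Proof. by []. Qed.
Fact bullet_connected (u v : unit) : connect e u v.
Proof. by case: u; case: v; apply: connect0. Qed.
Fact bullet_acyclic (c : seq unit) : ucycle e c -> (size c < 3)%N.
Proof. by case: c => [|a [|b c]] // /andP[]. Qed.

Definition bullet : rooted_tree :=
  RootedTree tt bullet_sym bullet_irr bullet_connected bullet_acyclic.
End Bullet.

Section Wedge.
Variables (k : nat) (T : 'I_k -> rooted_tree).

(* None is the new root, Some (Tagged _ v) is the vertex v of T i. *)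
Definition wedge_vertex : finType := option {i : 'I_k & vertex (T i)}.

Definition wedge_in (i : 'I_k) (v : vertex (T i)) : wedge_vertex :=
  Some (Tagged (fun i => vertex (T i)) v).

Definition wedge_adj : rel wedge_vertex := fun a b =>
  match a, b with
  | None, None => false
  | None, Some u | Some u, None => tagged u == root (T (tag u))
  | Some u, Some v => (tag u == tag v) && adj (tagged u) (tagged_as u v)
  end.

Lemma wedge_adj_in (i : 'I_k) (u v : vertex (T i)) :
  wedge_adj (wedge_in u) (wedge_in v) = adj u v.
Proof. by rewrite /= eqxx tagged_asE. Qed.

Lemma wedge_adj_diff (i j : 'I_k) (u : vertex (T i)) (v : vertex (T j)) :
  wedge_adj (wedge_in u) (wedge_in v) -> i = j.
Proof. by case/andP=> /eqP. Qed.

Lemma wedge_in_inj (i : 'I_k) : injective (@wedge_in i).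
Proof. by move=> u v [] /eqP; rewrite -tag_eqE /tag_eq eqxx tagged_asE => /eqP. Qed.

Fact wedge_sym : ssrbool.symmetric wedge_adj.
Proof.
move=> [[i u]|] [[j v]|] //.
have [eij|nij] := eqVneq i j; last by rewrite /= (negPf nij) eq_sym (negPf nij).
by case: j / eij v => v; rewrite !wedge_adj_in adj_sym.
Qed.

Fact wedge_irr : irreflexive wedge_adj.
Proof. by move=> [[i u]|] //; rewrite wedge_adj_in adj_irr. Qed.

Fact wedge_connected (a b : wedge_vertex) : connect wedge_adj a b.
Proof.
have csym : connect_sym wedge_adj by apply: sym_connect_sym; apply: wedge_sym.
suff h c : connect wedge_adj None c by apply: connect_trans (h b); rewrite csym.
case: c => [[i u]|]; last exact: connect0.
apply: (@connect_trans _ _ (wedge_in (root (T i)))).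
  by apply: connect1 => /=.
have /connectP[p pP ->] := adj_connected (root (T i)) u.
elim: p (root (T i)) pP => [|w p IHp] r /=; first by rewrite connect0.
case/andP=> rw pP; apply: connect_trans (IHp _ pP).
by apply: connect1; rewrite wedge_adj_in.
Qed.

Lemma wedge_path_in (i : 'I_k) (u : vertex (T i)) (s : seq wedge_vertex) :
  None \notin s -> path wedge_adj (wedge_in u) s ->
  exists2 s' : seq (vertex (T i)), s = map (@wedge_in i) s' & path (@adj (T i)) u s'.
Proof.
elim: s u => [|[[j v]|] s IHs] u //; first by exists [::].
rewrite inE /= => Ns /andP[uv sP].
have eij := wedge_adj_diff uv.
case: j / eij v uv sP => v uv sP.
have [s' -> s'P] := IHs v Ns sP.
exists (v :: s') => //=; rewrite s'P andbT.
by move: uv; rewrite -/(wedge_in u) -/(wedge_in v) eqxx tagged_asE.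
Qed.

Fact wedge_acyclic (c : seq wedge_vertex) : ucycle wedge_adj c -> (size c < 3)%N.
Proof.
case: (boolP (None \in c)) => [Nc|Nc] /andP[].
  case: (rot_to Nc) => i s rs; rewrite -(size_rot i c).
  rewrite -(rot_cycle i) -(rot_uniq i) rs /= rcons_path.
  case: s rs => [|[[j v]|] s] _ //=.
  case/andP=> /andP[/eqP vr sP] lr /and3P[Ns vs _]; move: Ns; rewrite inE /= => Ns.
  have [s' sE s'P] := wedge_path_in Ns sP; subst s.
  case: s' s'P vs lr {sP Ns} => [|w s'] //= _ vs.
  rewrite last_map => /eqP lr; case/negP: vs.
  rewrite -[Some _]/(wedge_in v) -map_cons (mem_map (@wedge_in_inj j)).
  by rewrite [v]vr -[in X in X \in _]lr mem_last.
case: c Nc => [|[[i v]|] s] //; rewrite inE /= => Ns.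
rewrite rcons_path => /andP[sP lP] /andP[vs us].
have [s' sE s'P] := wedge_path_in Ns sP; subst s.
have -> : size (map (@wedge_in i) s') = size s' by rewrite size_map.
apply: (@adj_acyclic (T i) (v :: s')); rewrite /ucycle /= rcons_path s'P /=.
rewrite -[Some _]/(wedge_in v) in lP vs.
rewrite last_map wedge_adj_in in lP; rewrite lP /=.
by rewrite -(mem_map (@wedge_in_inj i)) vs -(map_inj_uniq (@wedge_in_inj i)).
Qed.

Definition wedge : rooted_tree :=
  RootedTree (None : wedge_vertex) wedge_sym wedge_irr wedge_connected wedge_acyclic.

End Wedge.

(* The following facts show that tree_poly is a well-defined function on
   isomorphism classes satisfying the recursion P(bullet) = x and
   P(wedge(T_1, ..., T_k)) = y + P(T_1) ... P(T_k) for k >= 1. *)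

Lemma tree_poly_iso (T1 T2 : rooted_tree) :
  rooted_iso T1 T2 -> tree_poly T1 = tree_poly T2.
Proof.
case=> f [fbij fadj fr]; rewrite /tree_poly -fr -(bij_eq_card fbij).
have finj := bij_inj fbij.
elim: #|_| (root T1) {2 4}(root T1) => [|n IHn] p v //=.
have chE w : (f w \in children (@adj T2) (f p) (f v)) = (w \in children (@adj T1) p v).
  by rewrite !inE fadj (inj_eq finj).
have -> : (children (@adj T2) (f p) (f v) == set0) = (children (@adj T1) p v == set0).
  have [g gK fK] := fbij.
  apply/eqP/eqP => /setP E; apply/setP => w; first by rewrite -chE E !inE.
  by rewrite -[w]fK chE E !inE.
case: ifP => // _; congr (_ + _).
rewrite [RHS](reindex f) /=; last by apply: onW_bij.
by apply: eq_big => [w|w _]; rewrite ?chE ?IHn.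
Qed.

Lemma tree_poly_bullet : tree_poly bullet = px.
Proof.
rewrite /tree_poly card_unit /=; case: ifP => // /eqP[].
by apply/setP=> w; rewrite !inE.
Qed.

Lemma children_walk (T : rooted_tree) (v w : vertex T) (s : seq (vertex T)) :
    path (@adj T) v s -> uniq (v :: s) -> w \in children (@adj T) (head v s) v ->
  path (@adj T) w (v :: s) && uniq (w :: v :: s).
Proof.
move=> sP us; rewrite inE => /andP[vw wp].
have -> : path (@adj T) w (v :: s) by rewrite /= adj_sym vw.
rewrite cons_uniq us andbT /= inE; apply/negP.
case/orP=> [/eqP wv|ws]; first by rewrite wv adj_irr in vw.
case/splitPr: ws sP us wp => s1 s2 sP us wp.
have us' : uniq (rcons (v :: s1) w).
  by move: us; rewrite -cat_cons -cat_rcons cat_uniq => /andP[].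
move: sP; rewrite cat_path /= => /and3P[s1P lw _].
have := @adj_acyclic T (rcons (v :: s1) w); rewrite /ucycle us' /= !rcons_path.
rewrite s1P lw last_rcons adj_sym vw size_rcons => /(_ isT).
by case: s1 wp {s1P lw us us'} => //=; rewrite eqxx.
Qed.

Lemma branch_poly_stable (T : rooted_tree) (n : nat) (v : vertex T)
    (s : seq (vertex T)) :
    path (@adj T) v s -> uniq (v :: s) -> (#|vertex T| < n + size (v :: s))%N ->
  branch_poly (@adj T) n.+1 (head v s) v = branch_poly (@adj T) n (head v s) v.
Proof.
elim: n v s => [|n IHn] v s sP us.
  by rewrite add0n ltnNge -(card_uniqP us) max_card.
move=> ltn; rewrite [LHS]/= [RHS]/=; case: ifP => // _.
congr (_ + _); apply: eq_bigr => w wc.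
have /andP[sP' us'] := children_walk sP us wc.
by apply: (IHn w (v :: s)) => //; move: ltn; rewrite /= addSnnS.
Qed.

Lemma branch_poly_enough (T : rooted_tree) (n : nat) : (#|vertex T| <= n)%N ->
  branch_poly (@adj T) n (root T) (root T) = tree_poly T.
Proof.
move=> /subnKC <-; elim: (n - _)%N => [|m IHm]; first by rewrite addn0.
rewrite addnS (@branch_poly_stable T _ _ [::]) //=.
by rewrite addn1 ltnS leq_addr.
Qed.

Lemma branch_poly_wedge (k : nat) (T : 'I_k -> rooted_tree) (i : 'I_k) (n : nat)
    (v : vertex (T i)) (s : seq (vertex (T i))) :
    path (@adj (T i)) v s -> uniq (v :: s) -> last v s = root (T i) ->
  branch_poly (@wedge_adj k T) n (head None (map (@wedge_in k T i) s)) (wedge_in v)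
    = branch_poly (@adj (T i)) n (head v s) v.
Proof.
elim: n v s => [|n IHn] v s sP us ls //.
have chE : children (@wedge_adj k T) (head None (map (@wedge_in k T i) s)) (wedge_in v)
    = @wedge_in k T i @: children (@adj (T i)) (head v s) v.
  apply/setP=> -[[j w]|]; rewrite -?/(wedge_in w).
    have [ij|nij] := eqVneq i j; last first.
      rewrite inE [wedge_adj _ _]/= (negPf nij); apply/esym/negP => /imsetP[u _].
      by case=> ji _; rewrite ji eqxx in nij.
    case: j / ij w => w; rewrite -/(wedge_in w) (mem_imset _ _ (@wedge_in_inj k T i)).
    rewrite !inE wedge_adj_in; case: s {sP us ls} => [|u s] /=.
      by case: eqP => [->|]; rewrite ?adj_irr ?andbT.
    by rewrite -/(wedge_in w) (inj_eq (@wedge_in_inj k T i)).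
  rewrite inE; apply/idP/imsetP => [|[u]] //.
  case: s sP us ls => [|u s] _; first by rewrite andbF.
  by move=> /andP[vs _] /= ls; rewrite [v == _]eq_sym -ls => /andP[/eqP lv _];
     rewrite -lv mem_last in vs.
rewrite [LHS]/= [RHS]/= chE imset_eq0; case: ifP => // _.
congr (_ + _); rewrite big_imset /=; last by move=> ? ? _ _; apply: wedge_in_inj.
apply: eq_bigr => w wc.
have /andP[sP' us'] := children_walk sP us wc.
exact: (IHn w (v :: s)).
Qed.

Lemma tree_poly_wedge (k : nat) (T : 'I_k.+1 -> rooted_tree) :
  tree_poly (wedge T) = py + \prod_(i < k.+1) tree_poly (T i).
Proof.
rewrite /tree_poly [#|_|]card_option /=.
pose r (i : 'I_k.+1) : wedge_vertex T := wedge_in (root (T i)).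
have r_inj : injective r by move=> i j [].
have -> : children (@wedge_adj _ T) None None = r @: setT.
  apply/setP=> -[[j w]|]; rewrite !inE.
    rewrite andbT /=; apply/eqP/imsetP => [->|[i _]]; first by exists j.
    move=> /Some_inj/eqP; rewrite -tag_eqE => /andP[/= /eqP ji].
    by case: i / ji; rewrite tagged_asE => /eqP.
  by rewrite andbF; apply/esym/negP => /imsetP[].
rewrite imset_eq0 -cards_eq0 cardsT card_ord /=; congr (_ + _).
rewrite big_imset /=; last by move=> ? ? _ _; apply: r_inj.
apply: eq_big => [i|i _]; first by rewrite inE.
rewrite (@branch_poly_wedge _ T i _ (root (T i)) [::]) //=.
apply: branch_poly_enough; apply: leq_card (fun u => Tagged (fun i => vertex (T i)) u) _.
by move=> u v /eqP; rewrite -tag_eqE /tag_eq eqxx tagged_asE => /eqP.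
Qed.

(* Main.v *)
From mathcomp Require Import all_boot all_order all_fingroup all_algebra.
From mathcomp Require Import ring.
From mathcomp.multinomials Require Import mpoly.
Require Import Defs.

(** The polynomial of a rooted tree determines the multiset of the polynomials
    of its branches, because each of these polynomials is irreducible: then
    P(T) - y is a product of irreducible factors, and unique factorization
    gives the factors back.  Induction on the tree concludes.

    To stay with polynomials in one variable, y is replaced by a prime number p
    larger than both trees (spec_poly).  Nothing needed is lost, and
    irreducibility becomes Eisenstein's criterion at p.  Indeed the value Q(T)
    of P(T) at y = p is a monic polynomial in x congruent to a power of x
    modulo p, and its constant term is c p modulo p ^ 2.  Adding p to a product
    increments c, while a product of two or more such polynomials has c = 0;
    hence c is the number of vertices, other than leaves, on the path that
    leads away from the root until it first branches or ends.  For a tree with at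
    least two vertices and at most p vertices this gives 0 < c < p, so that
    p ^ 2 does not divide the constant term (distinguished_irreducible), and
    in particular Q(T) is not x, the polynomial of the tree with one vertex
    (spec_poly_wedge_neqX).

    Unique factorization is applied over the rationals, where Q(T) remains
    irreducible (monic_irreducible_prod_inj, spec_poly_prod_inj): all the
    factors are monic, so they are equal and not merely associated.

    On the side of trees, every rooted tree is isomorphic to the wedge of the
    branches at the neighbours of its root (wedge_branches).  This yields an
    induction principle over bullet and wedge (rooted_tree_ind) and reduces
    the construction of an isomorphism to a matching of the branches
    (wedge_iso). *)

Set Implicit Arguments.
Unset Strict Implicit.
Unset Printing Implicit Defensive.

Import GRing.Theory Num.Theory.

Local Open Scope ring_scope.

(** * Unique factorization into monic irreducible polynomials *)

Section UniqueFactorization.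
Variable F : fieldType.

Definition monic_irreducible (f : {poly F}) := f \is monic /\ irreducible_poly f.

(** Euclid's lemma: an irreducible polynomial is coprime to what it does not
    divide. *)
Lemma irreducible_dvdp_prod (f : {poly F}) (s : seq {poly F}) :
  irreducible_poly f -> f %| \prod_(g <- s) g -> exists2 g, g \in s & f %| g.
Proof.
move=> irrf; elim: s => [|g s IHs].
  by rewrite big_nil dvdp1 => /eqP f1; have := irrf.1; rewrite f1.
rewrite big_cons; have [fg _|nfg] := boolP (f %| g).
  by exists g; rewrite ?mem_head.
rewrite Gauss_dvdpr ?irreducible_poly_coprime // => /IHs[h hs fh].
by exists h; rewrite // inE hs orbT.
Qed.

Lemma monic_irreducible_prod_inj (s t : seq {poly F}) :
    {in s, forall f, monic_irreducible f} ->
    {in t, forall f, monic_irreducible f} ->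
  \prod_(f <- s) f = \prod_(f <- t) f -> perm_eq s t.
Proof.
elim: s t => [|f s IHs] t mis mit.
  case: t mit => [|g t] // mit; rewrite big_nil big_cons => gt1.
  have [_ [g1 _]] := mit g (mem_head g t).
  have : g %| 1 by rewrite gt1 dvdp_mulIl.
  by rewrite dvdp1 => /eqP sg; rewrite sg in g1.
have [mf irrf] := mis f (mem_head f s).
move=> fst; have : f %| \prod_(g <- t) g by rewrite -fst big_cons dvdp_mulIl.
case/(irreducible_dvdp_prod irrf) => g gt fg.
have [mg irrg] := mit g gt.
have fE : f = g.
  apply/eqP; rewrite -eqp_monic //; apply: (apply_irredp irrg) => //.
  by rewrite neq_ltn irrf.1 orbT.
subst g; have tE := perm_to_rem gt.
rewrite perm_sym; apply: (perm_trans tE); rewrite perm_cons perm_sym.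
apply: IHs => [h hs|h hr|]; first by apply: mis; rewrite inE hs orbT.
  by apply: mit; apply: mem_rem hr.
by move: fst; rewrite (perm_big _ tE) /= !big_cons => /(mulfI (monic_neq0 mf)).
Qed.

End UniqueFactorization.

(** * Polynomials to which Eisenstein's criterion applies *)

Section Distinguished.
Variable p : nat.
Implicit Types (f g : {poly int}) (c d : nat).

(** These are the distinguished polynomials of Weierstrass preparation, with
    integer coefficients; c records the constant term, which is p c modulo
    p ^ 2 since 0 < m.  The form 'X^m + p g makes closure under products a
    computation. *)
Definition distinguished c f := exists m g,
  [/\ (0 < m)%N, (size g <= m)%N, f = 'X^m + p%:Z *: g & (g`_0 = c %[mod p])%Z].

Lemma distinguishedX : distinguished 0 'X.
Proof. by exists 1%N, 0; rewrite size_poly0 scaler0 addr0 expr1 coef0. Qed.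

Lemma distinguishedDp c f : distinguished c f -> distinguished c.+1 (p%:R + f).
Proof.
case=> m [g [m_gt0 sg -> gc]]; exists m, (1 + g); split=> //.
- by rewrite (leq_trans (size_polyD _ _)) // size_poly1 geq_max m_gt0.
- by rewrite scalerDr addrCA -[in p%:Z *: 1]natz scaler_nat.
by rewrite coefD coef1 -modzDmr gc modzDmr.
Qed.

(** Both constant terms are multiples of p, so that of the product is a multiple
    of p ^ 2 whatever c and d are. *)
Lemma distinguishedM c d f h :
  distinguished c f -> distinguished d h -> distinguished 0 (f * h).
Proof.
case=> m [g [m_gt0 sg -> _]] [n [k [n_gt0 sk -> _]]].
exists (m + n)%N, ('X^m * k + g * ('X^n + p%:Z *: k)); split.
- by rewrite addn_gt0 m_gt0.
- have sXk : (size ('X^n + p%:Z *: k)%R <= n.+1)%N.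
    rewrite (leq_trans (size_polyD _ _)) // size_polyXn geq_max leqnn /=.
    by rewrite (leq_trans (size_scale_leq _ _)) // ltnW.
  rewrite (leq_trans (size_polyD _ _)) // geq_max.
  apply/andP; split; apply: (leq_trans (size_polyMleq _ _)).
    by rewrite size_polyXn addSn /= leq_add2l.
  by rewrite -subn1 leq_subLR add1n -addnS leq_add.
- by rewrite exprD -!mul_polyC; ring.
rewrite coefD !coef0M coefD coefZ !coefXn !ltn_eqF // mul0r !add0r.
by rewrite mulrCA modzMr mod0z.
Qed.

Lemma distinguished_prod (k : nat) (f : 'I_k.+1 -> {poly int}) :
    (forall i, exists c, distinguished c (f i)) ->
  exists c, distinguished c (\prod_i f i).
Proof.
elim: k f => [|k IHk] f df; first by rewrite big_ord1.
rewrite big_ord_recl; have [c dc] := df ord0.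
have [d dd] := IHk _ (fun i => df (lift ord0 i)).
by exists 0%N; apply: distinguishedM dc dd.
Qed.

Lemma distinguished_prod_ge2 (k : nat) (f : 'I_k.+2 -> {poly int}) :
    (forall i, exists c, distinguished c (f i)) ->
  distinguished 0 (\prod_i f i).
Proof.
move=> df; rewrite big_ord_recl; have [c dc] := df ord0.
have [d dd] := distinguished_prod (fun i => df (lift ord0 i)).
exact: distinguishedM dc dd.
Qed.

Lemma distinguished_monic c f : distinguished c f -> f \is monic.
Proof.
case=> m [g [_ sg -> _]]; rewrite monicE lead_coefDl ?lead_coefXn //.
by rewrite size_polyXn ltnS (leq_trans (size_scale_leq _ _)).
Qed.

(** After division by p, the constant term is c modulo p. *)
Lemma distinguished_coef0 c f : distinguished c f ->
  (0 < p)%N -> (p%:Z ^+ 2 %| f`_0)%Z -> (p %| c)%N.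
Proof.
case=> m [g [m_gt0 _ -> gc]] p_gt0.
rewrite coefD coefXn ltn_eqF // add0r coefZ expr2 dvdz_mul2l ?lt0r_neq0 //.
move/dvdz_mod0P => g0; suff : (p %| c%:Z)%Z by [].
by apply/dvdz_mod0P; rewrite -gc.
Qed.

Hypothesis p_prime : prime p.

Lemma distinguished_irreducible c f :
  distinguished c f -> (0 < c < p)%N -> irreducible_poly f.
Proof.
move=> df cp; have mf := distinguished_monic df.
have p0 : ~~ (p%:Z ^+ 2 %| f`_0)%Z.
  apply/negP => /(distinguished_coef0 df (prime_gt0 p_prime)) pc.
  by case/andP: cp => c_gt0; rewrite ltnNge (dvdn_leq c_gt0 pc).
case: df => m [g [m_gt0 sg fE _]].
have sf : size f = m.+1.
  by rewrite fE size_polyDl size_polyXn // ltnS (leq_trans (size_scale_leq _ _)).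
apply: (eisenstein_crit p_prime).
- by rewrite sf; case: (m) m_gt0.
- by rewrite (monicP mf) dvdz1 absz_nat neq_ltn (prime_gt1 p_prime) orbT.
- by rewrite expr2 PoszM -expr2.
move=> i; rewrite sf /= => im; rewrite fE coefD coefXn ltn_eqF // add0r coefZ.
exact: dvdz_mulr.
Qed.

End Distinguished.

(** * Isomorphisms of rooted trees *)

Lemma rooted_iso_refl (T : rooted_tree) : rooted_iso T T.
Proof. by exists id; split=> //; exists id. Qed.

Lemma rooted_iso_sym (T1 T2 : rooted_tree) : rooted_iso T1 T2 -> rooted_iso T2 T1.
Proof.
case=> f [[g fK gK] fadj fr]; exists g; split; first by exists f.
- by move=> u v; rewrite -fadj !gK.
- by rewrite -fr fK.
Qed.

Lemma rooted_iso_trans (T1 T2 T3 : rooted_tree) :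
  rooted_iso T1 T2 -> rooted_iso T2 T3 -> rooted_iso T1 T3.
Proof.
case=> f [fbij fadj fr] [g [gbij gadj gr]]; exists (g \o f); split.
- exact: bij_comp.
- by move=> u v /=; rewrite gadj fadj.
- by rewrite /= fr.
Qed.

Lemma rooted_iso_card (T1 T2 : rooted_tree) :
  rooted_iso T1 T2 -> #|vertex T1| = #|vertex T2|.
Proof. by case=> f [/bij_eq_card]. Qed.

(** Since the types are finite, an inverse can be chosen without any axiom of
    choice. *)
Lemma rooted_iso_of_inj_surj (T1 T2 : rooted_tree) (f : vertex T1 -> vertex T2) :
    injective f -> (forall v, exists u, f u = v) -> {mono f : u v / adj u v} ->
  f (root T1) = root T2 -> rooted_iso T1 T2.
Proof.
move=> finj /fin_all_exists[g gK] fadj fr; exists f; split=> //.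
by exists g => //; apply: inj_can_sym gK finj.
Qed.

(** The hypotheses characterize the images of the T i as the branches of W.
    Used both to compare two wedges and to recognize an arbitrary tree as a
    wedge. *)
Lemma wedge_iso_of_branches (k : nat) (T : 'I_k -> rooted_tree) (W : rooted_tree)
    (h : forall i, vertex (T i) -> vertex W) :
    (forall i, injective (h i)) ->
    (forall i j u v, h i u = h j v -> i = j) ->
    (forall w, w != root W -> exists i u, h i u = w) ->
    (forall i u, h i u != root W) ->
    (forall i, {mono h i : u v / adj u v}) ->
    (forall i j u v, adj (h i u) (h j v) -> i = j) ->
    (forall i u, adj (root W) (h i u) = (u == root (T i))) ->
  rooted_iso (wedge T) W.
Proof.
move=> hinj hdisj hcover hroot hadj hcross hadjr.
pose f (a : wedge_vertex T) :=
  if a is Some u then h (tag u) (tagged u) else root W.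
apply: (@rooted_iso_of_inj_surj (wedge T) W f) => //.
- move=> [[i u]|] [[j v]|] //= huv.
  + have ij := hdisj _ _ _ _ huv; case: j / ij v huv => v huv.
    by rewrite (hinj _ _ _ huv).
  + by have := hroot i u; rewrite huv eqxx.
  + by have := hroot j v; rewrite -huv eqxx.
- move=> w; have [->|/hcover[i [u <-]]] := eqVneq w (root W); first by exists None.
  by exists (wedge_in u).
move=> [[i u]|] [[j v]|] /=.
- have [ij|nij] := eqVneq i j; first by case: j / ij v => v; rewrite hadj tagged_asE.
  by apply/negP => /hcross ij; rewrite ij eqxx in nij.
- by rewrite adj_sym hadjr.
- by rewrite hadjr.
by rewrite adj_irr.
Qed.

Lemma wedge_iso (k : nat) (T U : 'I_k -> rooted_tree) (s : 'I_k -> 'I_k) :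
  injective s -> (forall i, rooted_iso (T i) (U (s i))) ->
  rooted_iso (wedge T) (wedge U).
Proof.
move=> sinj /fin_all_exists[f fiso].
have finj i : injective (f i) by case: (fiso i) => /bij_inj.
apply: (@wedge_iso_of_branches k T (wedge U) (fun i u => wedge_in (f i u))) => //.
- by move=> i; apply: inj_comp (@wedge_in_inj _ U (s i)) (finj i).
- by move=> i j u v [/sinj].
- move=> [[j w]|] // _.
  have [s' sK s'K] := injF_bij sinj; rewrite -[j]s'K in w *.
  have [[g _ gK] _ _] := fiso (s' j).
  by exists (s' j), (g w); rewrite gK.
- move=> i u v; rewrite [LHS]wedge_adj_in; by case: (fiso i) => _ ->.
- by move=> i j u v /wedge_adj_diff/sinj.
- by move=> i u /=; case: (fiso i) => _ _ <-; rewrite (inj_eq (finj i)).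
Qed.

(** * Every rooted tree is the wedge of its branches *)

Section Branch.
Variables (T : rooted_tree) (w : vertex T).
Local Notation r := (root T).
(** Adjacency in the forest that remains when the root is removed; its
    connected components are the branches. *)
Definition off_root : rel (vertex T) := fun u v => [&& u != r, v != r & adj u v].

Lemma off_root_sym : ssrbool.symmetric off_root.
Proof. by move=> u v; rewrite /off_root adj_sym andbCA. Qed.

Definition in_branch : pred (vertex T) := connect off_root w.

Definition branch_vertex : finType := {v : vertex T | in_branch v}.

Definition branch_adj : rel branch_vertex := fun u v => adj (val u) (val v).

Definition branch_root : branch_vertex := Sub w (connect0 off_root w).

Lemma branch_sym : ssrbool.symmetric branch_adj.
Proof. by move=> u v; rewrite /branch_adj adj_sym. Qed.

Lemma branch_irr : irreflexive branch_adj.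
Proof. by move=> u; rewrite /branch_adj adj_irr. Qed.

(** A path off the root issued from w stays in the branch of w, hence lifts to
    the subtype of its vertices. *)
Lemma branch_connected (u v : branch_vertex) : connect branch_adj u v.
Proof.
have csym : connect_sym branch_adj by apply: sym_connect_sym; apply: branch_sym.
suff h x : connect branch_adj branch_root x by apply: connect_trans (h v); rewrite csym.
case: x => x bx; have /connectP[p pP lp] := bx.
have [q qP ql] : exists2 q, path branch_adj branch_root q & map val q = p.
  elim/last_ind: p pP {x bx lp} => [|p x IHp] pP; first by exists [::].
  have bx : in_branch x by apply/connectP; exists (rcons p x); rewrite ?last_rcons.
  move: pP; rewrite rcons_path => /andP[/IHp[q qP qp] /and3P[_ _ lx]].
  exists (rcons q (Sub x bx)); last by rewrite map_rcons qp.
  by rewrite rcons_path qP /branch_adj -last_map qp.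
apply/connectP; exists q => //; apply: val_inj.
by rewrite -(last_map val q branch_root) ql -lp.
Qed.

Lemma branch_acyclic (c : seq branch_vertex) : ucycle branch_adj c -> (size c < 3)%N.
Proof.
case/andP=> cc uc; rewrite -(size_map val); apply: (@adj_acyclic T).
rewrite /ucycle (map_inj_uniq val_inj) uc andbT.
by case: c cc {uc} => [|u c] //=; rewrite -map_rcons path_map.
Qed.

Definition branch : rooted_tree :=
  RootedTree branch_root branch_sym branch_irr branch_connected branch_acyclic.

Hypothesis rw : adj r w.

Lemma neighbour_neq_root : w != r.
Proof. by apply: contraTneq rw => ->; rewrite adj_irr. Qed.

Lemma path_off_root (p : seq (vertex T)) :
  path off_root w p = path (@adj T) w p && (r \notin p).
Proof.
elim: p w neighbour_neq_root => [|v p IHp] u ur //=.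
rewrite inE negb_or [r == v]eq_sym /off_root ur /=; case: (eqVneq v r) => [->|vr] /=.
  by rewrite andbF.
by rewrite IHp // andbA.
Qed.

Lemma in_branch_neq_root (v : vertex T) : in_branch v -> v != r.
Proof.
case/connectP=> p; rewrite path_off_root => /andP[_ rp] ->.
have := mem_last w p; rewrite inE => /orP[/eqP ->|lp]; first exact: neighbour_neq_root.
by apply: contraNneq rp => <-.
Qed.

Lemma in_branch_adj (u v : vertex T) :
  in_branch u -> v != r -> adj u v -> in_branch v.
Proof.
move=> bu vr uv; apply: connect_trans (bu) (connect1 _).
by rewrite /off_root vr uv in_branch_neq_root.
Qed.

(** This is where acyclicity enters: a second neighbour of the root in the
    branch of w would close, through the root, a cycle of length at least 3. *)
Lemma in_branch_adj_root (v : vertex T) : in_branch v -> adj r v -> v = w.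
Proof.
case/connectP=> p0 p0P ->; case/shortenP: p0P => p.
rewrite path_off_root => /andP[pP rp] up _ rl.
case: (lastP p) pP rp up rl => [|p' x] //; rewrite last_rcons => pP rp up rl.
have := @adj_acyclic T (r :: w :: rcons p' x).
rewrite /ucycle [path.cycle _ _]/= rcons_path rw pP last_rcons adj_sym rl.
rewrite cons_uniq inE negb_or eq_sym neighbour_neq_root rp up.
by move=> /(_ isT); rewrite /= size_rcons.
Qed.

End Branch.

(** If v lies in both branches, then w lies in the branch of w', of which w' is
    the only vertex adjacent to the root. *)
Lemma in_branch_disjoint (T : rooted_tree) (w w' v : vertex T) :
    adj (root T) w -> adj (root T) w' -> in_branch w v -> in_branch w' v -> w = w'.
Proof.
move=> rw rw' wv w'v; apply: (in_branch_adj_root rw' _ rw).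
by apply: connect_trans w'v _; rewrite (sym_connect_sym (@off_root_sym T)).
Qed.

(** A path without repetition from the root to v visits the root only at its
    start, so its second vertex is the neighbour sought. *)
Lemma in_some_branch (T : rooted_tree) (v : vertex T) :
  v != root T -> exists2 w, adj (root T) w & in_branch w v.
Proof.
move=> vr; have /connectP[p0 p0P vl] := adj_connected (root T) v.
case/shortenP: p0P vl => -[|w p] /=; first by move=> _ _ _ vl; rewrite vl eqxx in vr.
case/andP=> rw pP /andP[]; rewrite inE negb_or => /andP[_ rp] _ _ vl.
by exists w => //; apply/connectP; exists p; rewrite // path_off_root // pP.
Qed.

Lemma wedge_branches (T : rooted_tree) : exists k (U : 'I_k -> rooted_tree),
  rooted_iso (wedge U) T.
Proof.
pose C := children (@adj T) (root T) (root T).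
have CP (i : 'I_#|C|) : adj (root T) (enum_val i).
  by have := enum_valP i; rewrite inE => /andP[].
pose B (i : 'I_#|C|) := branch (enum_val i); exists #|C|, B.
apply: (@wedge_iso_of_branches _ B T (fun i (u : vertex (B i)) => val u)).
- by move=> i; apply: val_inj.
- move=> i j u v huv; apply: enum_val_inj.
  by apply: (in_branch_disjoint (CP i) (CP j) (valP u)); rewrite huv; apply: (valP v).
- move=> v /in_some_branch[w rw wv].
  have Cw : w \in C by rewrite inE rw (neighbour_neq_root rw).
  have bv : in_branch (enum_val (enum_rank_in Cw w)) v by rewrite enum_rankK_in.
  by exists (enum_rank_in Cw w), (Sub v bv).
- by move=> i u; apply: (in_branch_neq_root (CP i)); apply: valP.
- by [].
- move=> i j u v uv; apply: enum_val_inj.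
  apply: (in_branch_disjoint (CP i) (CP j) _ (valP v)).
  apply: (in_branch_adj (CP i) (valP u)) => //.
  by apply: (in_branch_neq_root (CP j)); apply: valP.
move=> i u; apply/idP/eqP => [ru|->]; last exact: CP.
by apply: val_inj; apply: (in_branch_adj_root (CP i)) ru; apply: valP.
Qed.

Lemma wedge0_iso (U : 'I_0 -> rooted_tree) : rooted_iso (wedge U) bullet.
Proof.
apply: (@wedge_iso_of_branches 0 U bullet (fun i _ => tt)).
all: by case.
Qed.

Lemma card_wedge (k : nat) (T : 'I_k -> rooted_tree) (i : 'I_k) :
  (#|vertex (T i)| < #|vertex (wedge T)|)%N.
Proof.
rewrite card_option ltnS; apply: leq_card (fun u => Tagged (fun i => vertex (T i)) u) _.
by move=> u v /eqP; rewrite -tag_eqE /tag_eq eqxx tagged_asE => /eqP.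
Qed.

(** Branches are strictly smaller than the tree, so the decomposition into
    branches can be iterated.  The closure of P under isomorphism is required
    because a tree is a wedge only up to isomorphism. *)
Lemma rooted_tree_ind (P : rooted_tree -> Prop) :
    (forall T U, rooted_iso T U -> P T -> P U) -> P bullet ->
    (forall k (U : 'I_k.+1 -> rooted_tree), (forall i, P (U i)) -> P (wedge U)) ->
  forall T, P T.
Proof.
move=> Piso Pbullet Pwedge T; have [n] := ubnP #|vertex T|.
elim: n T => // n IHn T ltTn; have [[|k] [U UT]] := wedge_branches T.
  exact: Piso UT (Piso _ _ (rooted_iso_sym (wedge0_iso U)) Pbullet).
apply: (Piso _ _ UT); apply: Pwedge => i; apply: IHn.
by apply: leq_trans (card_wedge U i) _; rewrite (rooted_iso_card UT).
Qed.

(** * The tree polynomial at a large prime value of y *)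

Section Specialization.
Variable p : nat.

Definition specialize : {mpoly int[2]} -> {poly int} :=
  mmap intr (fun i => if i == ord0 then 'X else p%:R).

Definition spec_poly (T : rooted_tree) := specialize (tree_poly T).

Lemma spec_poly_iso (T U : rooted_tree) :
  rooted_iso T U -> spec_poly T = spec_poly U.
Proof. by rewrite /spec_poly => /tree_poly_iso ->. Qed.

Lemma spec_poly_bullet : spec_poly bullet = 'X.
Proof. by rewrite /spec_poly tree_poly_bullet /specialize mmapX mmap1U eqxx. Qed.

Lemma spec_poly_wedge (k : nat) (T : 'I_k.+1 -> rooted_tree) :
  spec_poly (wedge T) = p%:R + \prod_i spec_poly (T i).
Proof.
by rewrite /spec_poly tree_poly_wedge /specialize rmorphD rmorph_prod /= mmapX mmap1U.
Qed.

(** With one branch c increases by 1, as the number of vertices does; with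
    several branches c is 1.  Either way c stays positive and below the number
    of vertices. *)
Lemma spec_poly_wedge_distinguished (k : nat) (T : 'I_k.+1 -> rooted_tree) :
    (forall i, exists2 c, (c < #|vertex (T i)|)%N &
       distinguished p c (spec_poly (T i))) ->
  exists2 c, (0 < c < #|vertex (wedge T)|)%N &
    distinguished p c (spec_poly (wedge T)).
Proof.
rewrite spec_poly_wedge; case: k T => [|k] T dT.
  have [c cT dc] := dT ord0; exists c.+1; last first.
    by rewrite big_ord1; apply: distinguishedDp.
  by rewrite ltnS; apply: leq_ltn_trans (card_wedge T ord0).
exists 1%N; last first.
  apply/distinguishedDp/distinguished_prod_ge2 => i.
  by have [c _ dc] := dT i; exists c.
have [c cT _] := dT ord0.
by rewrite (leq_ltn_trans _ (card_wedge T ord0)) // (leq_ltn_trans _ cT).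
Qed.

Lemma spec_poly_distinguished (T : rooted_tree) :
  exists2 c, (c < #|vertex T|)%N & distinguished p c (spec_poly T).
Proof.
elim/rooted_tree_ind: T => [T U TU|| k T dT].
- by rewrite (rooted_iso_card TU) (spec_poly_iso TU).
- by exists 0%N; rewrite ?spec_poly_bullet ?card_unit //; apply: distinguishedX.
by have [c /andP[_ cT] dc] := spec_poly_wedge_distinguished dT; exists c.
Qed.

Lemma spec_poly_monic (T : rooted_tree) : spec_poly T \is monic.
Proof. by have [c _ /distinguished_monic] := spec_poly_distinguished T. Qed.

Hypothesis p_prime : prime p.

(** The polynomial 'X has constant term 0, a multiple of p ^ 2. *)
Lemma spec_poly_wedge_neqX (k : nat) (T : 'I_k.+1 -> rooted_tree) :
  (#|vertex (wedge T)| <= p)%N -> spec_poly (wedge T) <> 'X.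
Proof.
move=> Tp TX.
have := spec_poly_wedge_distinguished (fun i => spec_poly_distinguished (T i)).
case=> c /andP[c_gt0 cT]; rewrite TX => /distinguished_coef0.
rewrite coefX dvdz0 prime_gt0 // => /(_ isT isT)/(dvdn_leq c_gt0).
by rewrite leqNgt (leq_trans cT).
Qed.

(** The bullet is apart: Eisenstein's criterion fails for 'X, which is
    irreducible by its degree. *)
Lemma spec_poly_irreducible (T : rooted_tree) :
  (#|vertex T| <= p)%N -> irreducible_poly (map_poly (intr : int -> rat) (spec_poly T)).
Proof.
elim/rooted_tree_ind: T => [T U TU|_| k T _ Tp].
- by rewrite (rooted_iso_card TU) (spec_poly_iso TU).
- by rewrite spec_poly_bullet map_polyX -['X]subr0; apply: irredp_XsubC.
have := spec_poly_wedge_distinguished (fun i => spec_poly_distinguished (T i)).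
case=> c /andP[c_gt0 cT] dc; apply/irreducible_rat_int.
by apply: (distinguished_irreducible p_prime dc); rewrite c_gt0 (leq_trans cT).
Qed.

Lemma spec_poly_prod_inj (k l : nat)
    (T : 'I_k -> rooted_tree) (U : 'I_l -> rooted_tree) :
    (forall i, #|vertex (T i)| <= p)%N -> (forall i, #|vertex (U i)| <= p)%N ->
    \prod_i spec_poly (T i) = \prod_i spec_poly (U i) ->
  perm_eq [seq spec_poly (T i) | i : 'I_k] [seq spec_poly (U i) | i : 'I_l].
Proof.
pose rat_poly := map_poly (intr : int -> rat).
have rat_poly_inj : injective rat_poly by apply: map_inj_poly intr_inj _.
move=> Tp Up /(congr1 rat_poly); rewrite /rat_poly !rmorph_prod => TU.
apply: (perm_map_inj rat_poly_inj).
have mi m (V : 'I_m -> rooted_tree) : (forall i, #|vertex (V i)| <= p)%N ->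
  {in [seq rat_poly f | f <- [seq spec_poly (V i) | i : 'I_m]],
     forall f, monic_irreducible f}.
  move=> Vp _ /mapP[_ /mapP[i _ ->] ->]; split; last exact: spec_poly_irreducible.
  exact: monic_map (spec_poly_monic (V i)).
apply: monic_irreducible_prod_inj; [exact: mi | exact: mi |].
by rewrite !big_map.
Qed.

(** Equal polynomials have equal multisets of factors, hence a permutation s
    such that the i-th branch of T and the s i-th branch of U have the same
    polynomial; by induction they are isomorphic. *)
Lemma spec_poly_inj (T U : rooted_tree) :
    (#|vertex T| <= p)%N -> (#|vertex U| <= p)%N ->
  spec_poly T = spec_poly U -> rooted_iso T U.
Proof.
elim/rooted_tree_ind: T U => [T T' TT' IH U|U|k T IH U].
- rewrite -(rooted_iso_card TT') -(spec_poly_iso TT') => Tp Up TU.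
  exact: rooted_iso_trans (rooted_iso_sym TT') (IH _ Tp Up TU).
- elim/rooted_tree_ind: U => [U U' UU' IH||l U _] Tp.
  + rewrite -(rooted_iso_card UU') -(spec_poly_iso UU') => Up E.
    exact: rooted_iso_trans (IH Tp Up E) UU'.
  + by move=> _ _; apply: rooted_iso_refl.
  by rewrite spec_poly_bullet => Up /esym/(spec_poly_wedge_neqX Up).
elim/rooted_tree_ind: U => [U U' UU' IHU||l U _] Tp.
- rewrite -(rooted_iso_card UU') -(spec_poly_iso UU') => Up E.
  exact: rooted_iso_trans (IHU Tp Up E) UU'.
- by rewrite spec_poly_bullet => _ /(spec_poly_wedge_neqX Tp).
move=> Up; rewrite !spec_poly_wedge => /addrI.
have Tip i := leq_trans (ltnW (card_wedge T i)) Tp.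
have Uip i := leq_trans (ltnW (card_wedge U i)) Up.
move=> /(spec_poly_prod_inj Tip Uip) TU.
have kl : k = l by have := perm_size TU; rewrite !size_image !card_ord => -[].
subst l; have /tuple_permP[s sE] : perm_eq
    [tuple spec_poly (T i) | i < k.+1] [tuple spec_poly (U i) | i < k.+1] by [].
apply: (@wedge_iso _ T U s); first exact: perm_inj.
move=> i; apply: IH => //.
by have := congr1 (fun t => tnth t i) (val_inj sE); rewrite !tnth_mktuple.
Qed.

End Specialization.

Theorem proposition2p7 (T1 T2 : rooted_tree) :
  tree_poly T1 = tree_poly T2 -> rooted_iso T1 T2.
Proof.
move=> T12; have [p] := prime_above (#|vertex T1| + #|vertex T2|).
move=> ltp p_prime; apply: (spec_poly_inj p_prime).
- exact: leq_trans (leq_addr _ _) (ltnW ltp).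
- exact: leq_trans (leq_addl _ _) (ltnW ltp).
by rewrite /spec_poly T12.
Qed.
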